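(* For every integer $k\ge 0$ the generating function of the numbers $D_{2k+1}(n)$ satisfies $$\sum_{n\geq 0} D_{2k+1}(n)x^n = \frac{B_{2k+1}(x)}{(1+x^2)^{k^2+k+1}},$$ where $B_{2k+1}(x)$ is a polynomial of degree $2k^2+1$ which satisfies $$x^{2k^2+1} B_{2k+1}\left(\frac{1}{x}\right) = (-1)^k B_{2k+1}(x).$$
   Context: For $m\ge 0$ let $b(m)=\binom{m}{\lfloor m/2\rfloor}$, and let $D_k(n)=\det\left(b(k+i+j)\right)_{i,j=0}^{n-1}$, with $D_k(0)=1$. The generating function is a formal power series in $x$. *)

(* Defs.v *)
From mathcomp Require Import all_boot all_order all_algebra.

Set Implicit Arguments.
Unset Strict Implicit.
Unset Printing Implicit Defensive.

Import GRing.Theory.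
Local Open Scope ring_scope.

Definition b (m : nat) : nat := 'C(m, m %/ 2).

(* The determinant of the empty matrix is 1, so D k 0 = 1 (see D0). *)
Definition D (k n : nat) : int :=
  \det (\matrix_(i < n, j < n) (b (k + i + j))%:Z).

Lemma D0 (k : nat) : D k 0 = 1.
Proof. exact: det_mx00. Qed.

(* A formal power series is identified with its sequence of coefficients. *)
Definition fps (R : Type) : Type := nat -> R.

Definition fps_of_poly (R : nzRingType) (p : {poly R}) : fps R :=
  fun n => p`_n.

Definition fps_mul (R : nzRingType) (f g : fps R) : fps R :=
  fun n => \sum_(i < n.+1) f i * g (n - i)%N.

(* f = p / q in R[[x]]; meaningful when q is a unit of R[[x]], that is, when
   q`_0 is a unit of R. By fps_quotient_uniq such an f is then unique. *)
Definition fps_is_quotient (R : comUnitRingType) (f : fps R)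
    (p q : {poly R}) : Prop :=
  q`_0 \is a GRing.unit /\ fps_mul (fps_of_poly q) f =1 fps_of_poly p.

Lemma fps_quotient_uniq (R : comUnitRingType) (f g : fps R) (p q : {poly R}) :
  fps_is_quotient f p q -> fps_is_quotient g p q -> f =1 g.
Proof.
move=> [uq Hf] [_ Hg] n.
elim/ltn_ind: n => n IHn.
have := etrans (Hf n) (esym (Hg n)).
rewrite /fps_mul !big_ord_recl subn0.
rewrite [X in _ + X = _](eq_bigr (fun i : 'I_n =>
  fps_of_poly q (lift ord0 i) * g (n - lift ord0 i)%N)); last first.
  by move=> i _; rewrite IHn // lift0 ltn_subrL /= (leq_ltn_trans _ (ltn_ord i)).
by move/addIr/(mulrI uq).
Qed.

(* B(1/x), as an element of the fraction field of R[x]. *)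
Definition eval_inv_X (R : idomainType) (p : {poly R}) : {fraction {poly R}} :=
  (map_poly (fun c : R => tofrac c%:P) p).[(tofrac 'X)^-1].

(* Main.v *)
Require Import Defs.
From mathcomp Require Import all_boot all_order all_algebra.
From mathcomp Require Import perm zify ring.

Set Implicit Arguments.
Unset Strict Implicit.
Unset Printing Implicit Defensive.

Import GRing.Theory.
Local Open Scope ring_scope.

(** The numbers b(m) are the moments of the weight (2 + x) / (2 pi sqrt(4 - x^2))
on [-2, 2], whose orthonormal polynomials are p_n = U_(n+1) - U_n, with U_n the
Chebyshev polynomials given by U_0 = 0, U_1 = 1, U_(n+2) = x U_(n+1) - U_n.
Since D_K(n) is the Hankel determinant of the same weight times x^K,
Christoffel's formula ([Hankel_Christoffel]) turns it into a determinant whose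
size K does not depend on n:

  D_K(n) = (-1)^(nK) det ([x^j] p_(n+i)), 0 <= i, j < K.

Here n may be any integer, because the recurrence x p_n = p_(n+1) + p_(n-1)
extends p to negative indices, by p_(-1-n) = p_n. Let K = 2k + 1. By the same
recurrence, the K consecutive polynomials p_n, ..., p_(n+2k) are combinations,
with coefficients independent of n, of the K polynomials x^i p_N (i <= k) and
x^i p_(N+1) (i < k), where N = n + k is the middle index. So D_(2k+1)(n) is
(-1)^n times a constant times the determinant of the latter family modulo x^K
([det_window]), and everything is read off from this second determinant.

- Degree. On each class of n modulo 4, the coefficient of x^j in p_n is a
  polynomial in n of degree at most j, which changes sign with n -> n + 2 up to
  lower degree; precisely, the operator E^2 + 1, with E the shift of n, kills
  this coefficient after j + 1 applications. In the second
  determinant the entry in column j and in a row carrying the factor x^i thus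
  has degree at most j - i, and the determinant has degree at most
  (0 + 1 + ... + 2k) - (0 + ... + k) - (0 + ... + (k-1)) = k^2 + k
  ([det_center_quasi]). Hence (1 + x^2)^(k^2+k+1) is a denominator.
- Reciprocity. Replacing N by -1 - N replaces p_N by itself and p_(N+1) by
  p_(N-1) = x p_N - p_(N+1), which multiplies the determinant by (-1)^k
  ([det_center_refl]).
- Zeros. For 0 <= N < k all the polynomials of the family have degree less than
  2k, so the last column vanishes; by reciprocity the determinant vanishes for
  -k <= N < k, that is for -2k <= n <= -1 ([det_center_eq0]).

The denominator has degree 2k^2 + 2k + 2. Annihilation on all of Z rewrites a
coefficient of the numerator, a sum over the values of f at nonnegative
integers, as minus a sum over the values at negative ones. The zeros and the
reciprocity f(-n-2k-1) = (-1)^(k+1) f(n) then give at once that the numerator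
has degree at most 2k^2 + 1 ([numer_eq0]) and that it is palindromic up to the
sign (-1)^k ([numer_refl]); its constant term D_(2k+1)(0) = 1 makes the degree
exact. *)

(** * Determinants of leading sections *)

(** Entries are indexed by natural numbers, so that determinants of different
sizes, or of sizes n + K and K + n, are compared without casts. *)
Definition ldet (R : comNzRingType) (N : nat) (F : nat -> nat -> R) : R :=
  \det (\matrix_(i < N, j < N) F i j).

Lemma eq_ldet (R : comNzRingType) N (F G : nat -> nat -> R) :
  (forall i j, (i < N)%N -> (j < N)%N -> F i j = G i j) -> ldet N F = ldet N G.
Proof. by move=> FG; congr (\det _); apply/matrixP=> i j; rewrite !mxE FG. Qed.

Lemma ldet_mul (R : comNzRingType) N (F G : nat -> nat -> R) :
  ldet N F * ldet N G = ldet N (fun i j => \sum_(l < N) F i l * G l j).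
Proof.
rewrite /ldet -det_mulmx; congr (\det _); apply/matrixP=> i j.
by rewrite !mxE; apply: eq_bigr => l _; rewrite !mxE.
Qed.

Lemma ldet_tr (R : comNzRingType) N (F : nat -> nat -> R) :
  ldet N (fun i j => F j i) = ldet N F.
Proof.
by rewrite /ldet -[RHS]det_tr; congr (\det _); apply/matrixP=> i j; rewrite !mxE.
Qed.

Lemma ldet_unitrig (R : comNzRingType) N (F : nat -> nat -> R) :
  (forall i, F i i = 1) -> (forall i j, (i < j)%N -> F i j = 0) -> ldet N F = 1.
Proof.
move=> F1 F0; rewrite /ldet det_trig.
  by rewrite big1 // => i _; rewrite mxE F1.
by apply/is_trig_mxP=> i j lij; rewrite mxE F0.
Qed.

Lemma ldet_id_first (R : comNzRingType) n K (F : nat -> nat -> R) :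
  ldet (n + K) (fun i j => if (j < n)%N then (i == j)%:R else F i (j - n)%N)
  = ldet K (fun i j => F (n + i)%N j).
Proof.
elim: n F => [|n IHn] F; first by apply: eq_ldet => i j _ _; rewrite subn0.
rewrite /ldet addSn (expand_det_col _ ord0) big_ord_recl big1 ?addr0; last first.
  by move=> i _; rewrite !mxE lift0 /= mul0r.
rewrite mxE /= mul1r /cofactor addn0 expr0 mul1r.
rewrite -[RHS](IHn (fun i j => F i.+1 j)) /ldet.
by congr (\det _); apply/matrixP=> i j; rewrite !mxE !lift0.
Qed.

(** Each column of the identity part is removed by expanding along the last
column: its entry 1 is in row K and in column K + n, hence a sign (-1)^n for
each of the K columns. *)
Lemma ldet_id_last (R : comNzRingType) n K (F : nat -> nat -> R) :
  ldet (K + n) (fun i j => if (j < n)%N then F i j else (i == j - n)%N%:R)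
  = (-1) ^+ (n * K) * ldet n (fun i j => F (K + i)%N j).
Proof.
elim: K F => [|K IHK] F.
  by rewrite muln0 mul1r; apply: eq_ldet => i j _ ->.
have KltKn : (K < (K + n).+1)%N by rewrite ltnS leq_addr.
pose oK := Ordinal KltKn.
rewrite /ldet addSn (expand_det_col _ ord_max) (bigD1 oK) //= big1 ?addr0.
  rewrite mxE /= ltnNge leq_addl /= addnK eqxx mul1r /cofactor /=.
  have -> : (-1) ^+ (K + (K + n)) = (-1) ^+ n :> R by rewrite !exprD signrMK.
  rewrite mulnS exprD -mulrA; congr (_ * _).
  transitivity ((-1) ^+ (n * K) * ldet n (fun i j => F (bump K (K + i)) j)).
    rewrite -(IHK (fun i j => F (bump K i) j)) /ldet.
    congr (\det _); apply/matrixP=> i j; rewrite !mxE /=.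
    have := ltn_ord j; rewrite /bump => ltj.
    have -> : (K + n <= j)%N = false by lia.
    rewrite add0n; case: ltnP => // lenj.
    by congr (nat_of_bool _)%:R; case: (leqP K i) => cK; lia.
  congr (_ * _); apply: (@eq_ldet _ _ _ (fun i j => F (K.+1 + i)%N j)) => i j _ _.
  by rewrite /bump leq_addr.
move=> i neq; rewrite mxE /= ltnNge leq_addl /= addnK.
case: eqP => [eiK|]; last by rewrite mul0r.
by case/eqP: neq; apply: val_inj.
Qed.

(** * Chebyshev polynomials and the orthonormal polynomials of b *)

(** Consecutive pairs turn the recurrence of order two into a structural
recursion. *)
Fixpoint cheb_pair (n : nat) : {poly int} * {poly int} :=
  if n is m.+1 then let: (u, v) := cheb_pair m in (v, 'X * v - u) else (0, 1).
Definition cheb n := (cheb_pair n).1.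

Lemma cheb0 : cheb 0 = 0. Proof. by []. Qed.
Lemma cheb1 : cheb 1 = 1. Proof. by []. Qed.
Lemma chebSS n : cheb n.+2 = 'X * cheb n.+1 - cheb n.
Proof. by rewrite /cheb /=; case: (cheb_pair n). Qed.

Lemma nat_two_step_ind (P : nat -> Prop) :
  P 0%N -> P 1%N -> (forall n, P n -> P n.+1 -> P n.+2) -> forall n, P n.
Proof.
move=> P0 P1 PS n; suff [] : P n /\ P n.+1 by [].
by elim: n => // n [Pn Pn1]; split=> //; apply: PS.
Qed.

Lemma cheb_coef_gt n j : (n <= j)%N -> (cheb n)`_j = 0.
Proof.
elim/nat_two_step_ind: n j => [j _|[|j] // _|n IHn IHn1 [|j] //].
- by rewrite coef0.
- by rewrite coef1.
by move=> lenj; rewrite chebSS coefB coefXM /= IHn1 // IHn ?subr0 //; lia.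
Qed.

Lemma cheb_coef_lead n : (cheb n.+1)`_n = 1.
Proof.
elim: n => [|n IHn]; first by rewrite coef1.
by rewrite chebSS coefB coefXM /= IHn cheb_coef_gt ?subr0.
Qed.

Lemma size_cheb n : (size (cheb n) <= n)%N.
Proof. by apply/leq_sizeP => j; apply: cheb_coef_gt. Qed.

(** With x = 2 cos t this is cos ((n + 1/2) t) / cos (t / 2), the Chebyshev
polynomial of the third kind. *)
Definition orth n := cheb n.+1 - cheb n.

Lemma orthSS n : orth n.+2 = 'X * orth n.+1 - orth n.
Proof. by rewrite /orth !chebSS; ring. Qed.

Lemma orth0 : orth 0 = 1. Proof. by rewrite /orth cheb0 cheb1 subr0. Qed.
Lemma orth1 : orth 1 = 'X - 1.
Proof. by rewrite /orth chebSS cheb0 cheb1 mulr1 subr0. Qed.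

Lemma orth_coef_gt n j : (n < j)%N -> (orth n)`_j = 0.
Proof. by move=> ltnj; rewrite coefB !cheb_coef_gt ?subr0 // ltnW. Qed.

Lemma orth_coef_lead n : (orth n)`_n = 1.
Proof. by rewrite coefB cheb_coef_lead cheb_coef_gt ?subr0. Qed.

(** Closed form of L (x^i p_l), where L is the linear functional with moments
L (x^m) = b m; see [momentP]. *)
Definition moment (i l : nat) : nat :=
  if (l <= i)%N then 'C(i, (i - l)./2) else 0.

(** The recurrence of p_l in disguise: multiplying x^i by x is the same as
multiplying p_(l+1) by x, and x p_(l+1) = p_l + p_(l+2). *)
Lemma moment_pascal i l : (moment i.+1 l.+1 = moment i l + moment i l.+2)%N.
Proof.
rewrite /moment ltnS subSS; have [lt|ge] := ltnP l.+1 i.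
  have -> : (l <= i)%N by lia.
  have -> : ((i - l)./2 = (i - l.+2)./2.+1)%N by lia.
  by rewrite binS.
rewrite addn0; case: leqP => // lei; have -> : ((i - l)./2 = 0)%N by lia.
by rewrite !bin0.
Qed.

Lemma moment0 i : moment i 0 = b i.
Proof. by rewrite /moment /b /= subn0 divn2. Qed.

Lemma moment1 i : (b i.+1 = b i + moment i 1)%N.
Proof.
case: i => [|i] //; rewrite /b /moment !divn2 subn1 ltnS leq0n.
have [oi|ei] := boolP (odd i).
  have -> : (i.+1./2 = (i./2).+1)%N by lia.
  have -> : (i.+2./2 = (i./2).+1)%N by lia.
  by rewrite binS.
have -> : (i.+1./2 = i./2)%N by lia.
have -> : (i.+2./2 = (i./2).+1)%N by lia.
rewrite binS; congr (_ + _)%N.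
by rewrite -bin_sub; [congr 'C(_, _)|]; lia.
Qed.

(** Both sides satisfy the same recurrence in l. The number N of terms is kept
free because the coefficients of p_l vanish beyond l. *)
Lemma momentP N i l : (l < N)%N ->
  \sum_(j < N) (b (i + j))%:Z * (orth l)`_j = (moment i l)%:Z.
Proof.
move: i N; elim/nat_two_step_ind: l => [||l IHl IHl1] i [|N] // ltlN.
- rewrite orth0 big_ord_recl coef1 addn0 mulr1 big1 ?addr0 ?moment0 // => j _.
  by rewrite coef1 mulr0.
- case: N ltlN => // N _; rewrite orth1 2!big_ord_recl !coefB !coefX !coef1 /=.
  rewrite /bump /= big1; last by move=> j _; rewrite coefB coefX coef1 /= mulr0.
  by rewrite addn0 addn1 moment1; lia.
have <-: (moment i.+1 l.+1)%:Z - (moment i l)%:Z = (moment i l.+2)%:Z.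
  by rewrite moment_pascal; lia.
rewrite -(IHl _ N.+1); last by lia.
rewrite -(IHl1 _ N) //.
transitivity (\sum_(j < N.+1) (b (i + j))%:Z * ('X * orth l.+1)`_j
              - \sum_(j < N.+1) (b (i + j))%:Z * (orth l)`_j).
  rewrite -sumrB; apply: eq_bigr => j _.
  by rewrite orthSS coefB mulrBr.
congr (_ - _); rewrite big_ord_recl coefXM /= mulr0 add0r.
by apply: eq_bigr => j _; rewrite coefXM /= -[bump 0 j]/(j.+1) addSnnS.
Qed.

(** Orthonormality. The sum is L (p_i p_j), which is symmetric in i and j; as a
product of two lower triangular matrices it is also lower triangular, so only
the diagonal survives. *)
Lemma orth_moment_inv N i j : (i < N)%N -> (j < N)%N ->
  \sum_(l < N) (orth i)`_l * (moment l j)%:Z = (i == j)%:R.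
Proof.
pose G i j := \sum_(l < N) (orth i)`_l * (moment l j)%:Z.
have G0 i' j' : (i' < j')%N -> G i' j' = 0.
  move=> lt; apply: big1 => l _; have [le|gt] := leqP l i'.
    by rewrite /moment (_ : (j' <= l)%N = false) ?mulr0 //; lia.
  by rewrite orth_coef_gt ?mul0r.
have Gsym i' j' : (i' < N)%N -> (j' < N)%N -> G i' j' = G j' i'.
  move=> lti ltj.
  transitivity (\sum_(l < N) \sum_(m < N)
      (orth i')`_l * ((b (l + m))%:Z * (orth j')`_m)).
    by apply: eq_bigr => l _; rewrite -(momentP _ ltj) mulr_sumr.
  rewrite exchange_big; apply: eq_bigr => l _ /=.
  rewrite -(momentP _ lti) mulr_sumr; apply: eq_bigr => m _.
  by rewrite addnC; ring.
move=> lti ltj; rewrite -/(G i j); case: ltngtP => [/G0 //|gt|<-{j ltj}].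
  by rewrite Gsym // G0.
rewrite /G (bigD1 (Ordinal lti)) //= orth_coef_lead.
rewrite /moment leqnn subnn bin0 mulr1.
rewrite big1 ?addr0 // => l; rewrite -val_eqE /= => neq.
have [le|gt] := leqP l i; last by rewrite orth_coef_gt ?mul0r.
by rewrite (_ : (i <= l)%N = false) ?mulr0 //; lia.
Qed.

(** Let P be the unitriangular coefficient matrix of the p_i and M that of the
moments L (x^i p_l). Column operations by P turn D_K(n) into the lower left
minor of M with rows K, ..., K+n-1. Border this minor with columns of the
identity matrix and multiply by P, of determinant 1: because P M = 1, the
columns of M become columns of the identity, the columns of the identity become
columns of P, and the lower left minor of P is left. This is Jacobi's formula
for complementary minors of inverse matrices. *)
Lemma Hankel_Christoffel K n :
  D K n = (-1) ^+ (n * K) * ldet K (fun i j => (orth (n + i))`_j).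
Proof.
pose P i j : int := (orth i)`_j; pose M i l := (moment i l)%:Z.
have P1 N : ldet N P = 1.
  by apply: ldet_unitrig => *; rewrite /P ?orth_coef_lead ?orth_coef_gt.
have DM : D K n = ldet n (fun i l => M (K + i)%N l).
  rewrite -[LHS]mulr1 -[X in _ * X](P1 n) -(ldet_tr n P).
  rewrite (_ : D K n = ldet n (fun i j => (b (K + i + j))%:Z)) // ldet_mul.
  apply: eq_ldet => i l lti ltl; exact: momentP.
have Z1 : ldet (K + n) (fun i j => if (j < n)%N then M i j else (i == j - n)%N%:R)
    = ldet K (fun i j => P (n + i)%N j).
  rewrite -[LHS]mul1r -[X in X * _](P1 (K + n)%N) ldet_mul -ldet_id_first addnC.
  apply: eq_ldet => i j lti ltj.
  case: ltnP => [ltjn|lenj]; first exact: orth_moment_inv.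
  have ltjK : (j - n < n + K)%N by lia.
  rewrite (bigD1 (Ordinal ltjK)) //= eqxx mulr1 big1 ?addr0 // => l.
  by rewrite -val_eqE /= => /negbTE ->; rewrite mulr0.
by rewrite -Z1 ldet_id_last -DM signrMK.
Qed.

(** * Extension to negative indices *)

(** [Negz m] is -1-m, so the symmetry p_(-1-n) = p_n is built in. *)
Definition orthz (n : int) : {poly int} :=
  match n with Posz m => orth m | Negz m => orth m end.

Lemma orthz_refl n : orthz (- 1 - n) = orthz n.
Proof.
case: n => n; first by rewrite (_ : - 1 - _ = Negz n) //; lia.
by rewrite (_ : - 1 - _ = Posz n) //; lia.
Qed.

Lemma orthz_rec n : orthz (n + 1) + orthz (n - 1) = 'X * orthz n.
Proof.
have X1 : 'X * orth 0 = orth 1 + orth 0 by rewrite orth0 orth1; ring.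
have XS m : 'X * orth m.+1 = orth m.+2 + orth m by rewrite orthSS; ring.
case: n => [[|n]|[|n]].
- by rewrite (_ : 0 - 1 = Negz 0) // add0r -X1.
- rewrite (_ : _ + 1 = Posz n.+2); last by lia.
  by rewrite (_ : _ - 1 = Posz n) ?XS //; lia.
- by rewrite (_ : _ + 1 = Posz 0) // (_ : _ - 1 = Negz 1) //= addrC -X1.
rewrite (_ : _ + 1 = Negz n); last by lia.
by rewrite (_ : _ - 1 = Negz n.+2) /= ?XS 1?addrC //; lia.
Qed.

Lemma orthzSS n : orthz (n + 2) = 'X * orthz (n + 1) - orthz n.
Proof.
have := orthz_rec (n + 1).
by rewrite addrK -addrA => <-; rewrite addrK.
Qed.

(** The solutions of the recurrence form a module of rank two, and p is
determined by its values at N and N + 1. That the multipliers do not depend on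
N is what makes the change of family in [det_window] constant. *)
Lemma orthz_up N (j : nat) :
  orthz (N + j.+1%:Z) = cheb j.+1 * orthz (N + 1) - cheb j * orthz N.
Proof.
elim/nat_two_step_ind: j => [||j IH IH1].
- by rewrite cheb0 cheb1 mul1r mul0r subr0.
- by rewrite chebSS cheb0 cheb1 mulr1 subr0 mul1r -orthzSS.
rewrite (_ : N + j.+3%:Z = N + j.+1%:Z + 2); last by lia.
rewrite orthzSS (_ : N + j.+1%:Z + 1 = N + j.+2%:Z); last by lia.
by rewrite IH IH1 (chebSS j.+1) (chebSS j); ring.
Qed.

Lemma orthz_down N (j : nat) :
  orthz (N - j%:Z) = cheb j.+1 * orthz N - cheb j * orthz (N + 1).
Proof.
rewrite -(orthz_refl N) -(orthz_refl (N + 1)) -orthz_refl.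
rewrite (_ : - 1 - (N - j%:Z) = (- 1 - (N + 1)) + j.+1%:Z); last by lia.
by rewrite orthz_up (_ : - 1 - (N + 1) + 1 = -1 - N) //; lia.
Qed.

(** * Centred form of the Christoffel determinant *)
Definition center_mx k N : 'M[int]_(k.+1 + k) :=
  col_mx (\matrix_(i < k.+1) poly_rV ('X^i * orthz N))
         (\matrix_(i < k) poly_rV ('X^i * orthz (N + 1))).

Definition window_mx k n : 'M[int]_(k.+1 + k) :=
  \matrix_(i < k.+1 + k) poly_rV (orthz (n + i%:Z)).

Lemma poly_rV_mul (R : comNzRingType) (d m : nat) (a q : {poly R}) :
  (size a <= d)%N ->
  (poly_rV a : 'rV_d) *m \matrix_(i < d) poly_rV ('X^i * q)
  = poly_rV (a * q) :> 'rV_m.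
Proof.
move=> sa; rewrite mulmx_sum_row [in RHS](_ : a = \poly_(i < d) a`_i).
  rewrite poly_def mulr_suml linear_sum; apply: eq_bigr => i _.
  by rewrite rowK mxE -scalerAl linearZ.
apply/polyP=> i; rewrite coef_poly; case: ltnP => // lei.
by rewrite nth_default // (leq_trans sa).
Qed.

(** The row p_(n+i) is at distance at most k from the centre n + k, so the
Chebyshev multipliers have degree at most k in front of p_(n+k) and less than k
in front of p_(n+k+1): exactly the multiples listed in [center_mx]. *)
Lemma window_row k (i : 'I_(k.+1 + k)) : exists v : 'rV_(k.+1 + k),
  forall n, row i (window_mx k n) = v *m center_mx k (n + k%:Z).
Proof.
suff [a [c [sa sc ac]]] : exists a c : {poly int},
    [/\ (size a <= k.+1)%N, (size c <= k)%N
      & forall N, orthz (N - k%:Z + i%:Z) = a * orthz N + c * orthz (N + 1)].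
  exists (row_mx (poly_rV a) (poly_rV c)) => n.
  by rewrite rowK mul_row_col !poly_rV_mul // -linearD -ac addrK.
have ltiK := ltn_ord i; have [lei|lti] := leqP i k.
  exists (cheb (k - i).+1), (- cheb (k - i)); split=> [||N].
  - by apply: leq_trans (size_cheb _) _; lia.
  - by rewrite size_polyN; apply: leq_trans (size_cheb _) _; lia.
  by rewrite mulNr -orthz_down; congr orthz; lia.
have [j ej] : exists j, (i : nat) = (k + j.+1)%N by exists (i - k.+1)%N; lia.
exists (- cheb j), (cheb j.+1); split=> [||N].
- by rewrite size_polyN; apply: leq_trans (size_cheb _) _; lia.
- by apply: leq_trans (size_cheb _) _; lia.
by rewrite mulNr [RHS]addrC -orthz_up; congr orthz; lia.
Qed.

Lemma det_window k : exists t : int,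
  forall n, \det (window_mx k n) = t * \det (center_mx k (n + k%:Z)).
Proof.
have /fin_all_exists[v Hv] := @window_row k.
exists (\det (\matrix_(i < k.+1 + k) v i)) => n.
rewrite -det_mulmx; congr (\det _); apply/row_matrixP => i.
by rewrite Hv row_mul rowK.
Qed.

(** The row x^i p_(N+1) becomes x^i p_(N-1) = x^(i+1) p_N - x^i p_(N+1). This is
a triangular change of rows with diagonal 1 (k + 1 times) and -1 (k times). *)
Lemma det_center_refl k N :
  \det (center_mx k (- 1 - N)) = (-1) ^+ k * \det (center_mx k N).
Proof.
pose R : 'M[int]_(k, k.+1) := \matrix_(i < k) poly_rV 'X^(i.+1).
suff -> : center_mx k (- 1 - N) = block_mx 1%:M 0 R (- 1%:M) *m center_mx k N.
  by rewrite det_mulmx det_lblock det1 mul1r -scaleN1r detZ det1 mulr1.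
rewrite /center_mx mul_block_col mul1mx mul0mx addr0 orthz_refl; congr col_mx.
apply/row_matrixP => i.
rewrite linearD /= rowK row_mul rowK mulNmx mul1mx linearN /= rowK.
rewrite poly_rV_mul; last by rewrite size_polyXn ltnS.
rewrite -linearB /=; congr poly_rV.
rewrite (_ : - 1 - N + 1 = - 1 - (N - 1)); last by lia.
by rewrite orthz_refl exprS mulrAC -orthz_rec; ring.
Qed.

(** Row degrees are at most N + k < 2k, so the last column is zero. *)
Lemma det_center_eq0_nat k (N : nat) : (N < k)%N -> \det (center_mx k N%:Z) = 0.
Proof.
move=> ltNk; have ltc : (k + k < k.+1 + k)%N by lia.
pose c : 'I_(k.+1 + k) := Ordinal ltc.
rewrite (expand_det_col _ c) big1 // => i _.
suff -> : center_mx k N%:Z i c = 0 by rewrite mul0r.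
rewrite mxE; case: (split i) => j; rewrite !mxE coefXnM; case: ltnP => // lej.
  by rewrite orth_coef_gt //=; have := ltn_ord j; lia.
rewrite (_ : N%:Z + 1 = N.+1%:Z); last by lia.
by rewrite orth_coef_gt //=; have := ltn_ord j; lia.
Qed.

Lemma det_center_eq0 k N :
  (- k%:Z <= N)%R -> (N < k%:Z)%R -> \det (center_mx k N) = 0.
Proof.
case: N => N leN ltN; first by apply: det_center_eq0_nat; lia.
have -> : Negz N = - 1 - N%:Z by lia.
by rewrite det_center_refl det_center_eq0_nat ?mulr0 //; lia.
Qed.

(** * Quasi-polynomials of step two *)

(** [quasi s d f] means (E^2 - s)^d f = 0 with E the shift. For s = 1 or -1 and
in characteristic 0, such an f is on each class of n modulo 2 a polynomial of
degree less than d, times s^(floor(n/2)). The operator form needs no division, and the bound d = 0 for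
the zero function plays the part of a negative degree. *)
Fixpoint quasi (R : comNzRingType) (s : R) (d : nat) (f : int -> R) : Prop :=
  if d is e.+1 then quasi s e (fun n => f (n + 2) - s * f n)
  else forall n, f n = 0.

Lemma eq_quasi (R : comNzRingType) (s : R) (d : nat) (f g : int -> R) :
  f =1 g -> quasi s d f -> quasi s d g.
Proof.
elim: d f g => [|d IHd] f g fg /=; first by move=> f0 n; rewrite -fg.
by apply: IHd => n; rewrite !fg.
Qed.

Lemma quasi_eq0 (R : comNzRingType) (s : R) (d : nat) (f : int -> R) :
  (forall n, f n = 0) -> quasi s d f.
Proof.
by elim: d f => //= d IHd f f0; apply: IHd => n; rewrite !f0 mulr0 subr0.
Qed.

Lemma quasiD (R : comNzRingType) (s : R) (d : nat) (f g : int -> R) :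
  quasi s d f -> quasi s d g -> quasi s d (fun n => f n + g n).
Proof.
elim: d f g => [|d IHd] f g /= qf qg; first by move=> n; rewrite qf qg addr0.
by apply: eq_quasi (IHd _ _ qf qg) => n; ring.
Qed.

Lemma quasiZ (R : comNzRingType) (s c : R) (d : nat) (f : int -> R) :
  quasi s d f -> quasi s d (fun n => c * f n).
Proof.
elim: d f => [|d IHd] f /= qf; first by move=> n; rewrite qf mulr0.
by apply: eq_quasi (IHd _ qf) => n; ring.
Qed.

Lemma quasi_shift (R : comNzRingType) (s : R) (d : nat) (c : int) (f : int -> R) :
  quasi s d f -> quasi s d (fun n => f (n + c)).
Proof.
elim: d f => [|d IHd] f /= qf; first by move=> n; rewrite qf.
by apply: eq_quasi (IHd _ qf) => n; rewrite addrAC.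
Qed.

(** Degrees add: (E^2 - st)(f g) = (E^2 - s) f . E^2 g + s f . (E^2 - t) g,
and each of the two terms has lost a degree. *)
Lemma quasiM (R : comNzRingType) (s t : R) (a c : nat) (f g : int -> R) :
  quasi s a.+1 f -> quasi t c.+1 g ->
  quasi (s * t) (a + c).+1 (fun n => f n * g n).
Proof.
have [m] := ubnP (a + c); elim: m a c f g => // m IHm a c f g ltm qf qg /=.
pose f1 n := f (n + 2) - s * f n; pose g1 n := g (n + 2) - t * g n.
apply: (@eq_quasi _ _ _ (fun n => f1 n * g (n + 2) + s * (f n * g1 n))).
  by move=> n; rewrite /f1 /g1; ring.
apply: quasiD; last apply: quasiZ.
  case: a ltm qf => [|a] ltm qf.
    by apply: quasi_eq0 => n; rewrite [f1 n]qf mul0r.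
  by apply: (IHm a c f1 (fun n => g (n + 2))) => //; apply: quasi_shift.
case: c ltm qg => [|c] ltm qg.
  by apply: quasi_eq0 => n; rewrite [g1 n]qg mulr0.
by rewrite addnS; apply: (IHm a c f g1) => //; rewrite addnS in ltm.
Qed.

(** The degree bounds a - a' and c - c' may be negative, in which case one of the
factors is zero; the truncated subtractions account for this. *)
Lemma quasiM_wt (R : comNzRingType) (s t : R) (a c a' c' : nat) (f g : int -> R) :
  quasi s (a.+1 - a') f -> quasi t (c.+1 - c') g ->
  quasi (s * t) ((a + c).+1 - (a' + c')) (fun n => f n * g n).
Proof.
have [lea|lta] := leqP a' a; last first.
  rewrite (_ : (a.+1 - a' = 0)%N); last by lia.
  by move=> /= f0 _; apply: quasi_eq0 => n; rewrite f0 mul0r.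
have [lec|ltc] := leqP c' c; last first.
  rewrite (_ : (c.+1 - c' = 0)%N); last by lia.
  by move=> /= _ g0; apply: quasi_eq0 => n; rewrite g0 mulr0.
have -> : ((a + c).+1 - (a' + c') = ((a - a') + (c - c')).+1)%N by lia.
by rewrite !subSn //; apply: quasiM.
Qed.

(** If the entry (i, j) has degree at most w_j - v_i, then every term of the
Leibniz expansion has degree at most the sum of the w_j minus the sum of the
v_i. *)
Lemma quasi_det (R : comNzRingType) (s : R) N (w v : nat -> nat)
    (F : int -> 'M[R]_N) :
  (forall i j : 'I_N, quasi s ((w j).+1 - v i) (fun n => F n i j)) ->
  quasi (s ^+ N) ((\sum_(j < N) w j).+1 - \sum_(i < N) v i)
    (fun n => \det (F n)).
Proof.
move=> qF; rewrite /determinant.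
suff qS : forall r : seq 'S_N,
    quasi (s ^+ N) ((\sum_(j < N) w j).+1 - \sum_(i < N) v i)
      (fun n => \sum_(g <- r) (-1) ^+ g * \prod_i F n i (g i)) by exact: qS.
elim=> [|g r IHr]; first by apply: quasi_eq0 => n; rewrite big_nil.
apply: (@eq_quasi _ _ _ (fun n => (-1) ^+ g * \prod_i F n i (g i)
   + \sum_(g <- r) (-1) ^+ g * \prod_i F n i (g i))) => [n|].
  by rewrite big_cons.
apply: quasiD IHr; apply: quasiZ.
rewrite (reindex_inj (@perm_inj _ g)) /=.
suff : forall r' : seq 'I_N, quasi (s ^+ size r')
    ((\sum_(i <- r') w (g i)).+1 - \sum_(i <- r') v i)
    (fun n => \prod_(i <- r') F n i (g i)).
  by move/(_ (index_enum 'I_N)); rewrite {1}/index_enum -enumT size_enum_ord.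
elim=> [|i r' IH].
  apply: (@eq_quasi _ _ _ (fun=> 1)) => [n|]; first by rewrite big_nil.
  by rewrite !big_nil /= => n; rewrite mul1r subrr.
apply: (@eq_quasi _ _ _ (fun n => F n i (g i) * \prod_(i <- r') F n i (g i))).
  by move=> n; rewrite big_cons.
by rewrite !big_cons exprS; apply: quasiM_wt.
Qed.

(** p_(n+2) + p_n = x p_(n+1), so that E^2 + 1 lowers j by one. *)
Lemma orthz_coef_quasi j : quasi (-1) j.+1 (fun n => (orthz n)`_j).
Proof.
elim: j => [|j IHj].
  by move=> n /=; rewrite orthzSS coefB coefXM /=; ring.
apply: (@eq_quasi _ (-1) j.+1 (fun n => (orthz (n + 1))`_j)
  (fun n => (orthz (n + 2))`_j.+1 - -1 * (orthz n)`_j.+1)).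
  by move=> n; rewrite orthzSS coefB coefXM /=; ring.
exact: quasi_shift IHj.
Qed.

Lemma orthz_shift_coef_quasi i j c :
  quasi (-1) (j.+1 - i) (fun n => ('X^i * orthz (n + c))`_j).
Proof.
apply: (@eq_quasi _ _ _
  (fun n => if (j < i)%N then 0 else (orthz (n + c))`_(j - i))).
  by move=> n; rewrite coefXnM.
case: ltnP => [ltji|leij]; first exact: quasi_eq0.
by rewrite subSn //; apply: quasi_shift (orthz_coef_quasi _).
Qed.

Lemma sum_ord_double n : ((\sum_(i < n) i).*2 + n = n * n)%N.
Proof.
elim: n => [|n IHn]; rewrite ?big_ord0 // big_ord_recr /=.
by move: (\sum_(i < n) i)%N IHn; nia.
Qed.

(** [quasi_det] with column weight j, and with row weight the exponent of x that
multiplies p_N or p_(N+1). *)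
Lemma det_center_quasi k :
  quasi (-1) (k ^ 2 + k + 1) (fun N => \det (center_mx k N)).
Proof.
(* the k + 1 multiples of p_N come first, then the k multiples of p_(N+1) *)
pose v i := if (i < k.+1)%N then i else (i - k.+1)%N.
have := @quasi_det int (-1) (k.+1 + k) id v (center_mx k).
have -> : (-1) ^+ (k.+1 + k) = -1 :> int.
  by rewrite -signr_odd (_ : odd (k.+1 + k)) //; lia.
have -> : ((\sum_(j < k.+1 + k) id j).+1 - \sum_(i < k.+1 + k) v i
           = k ^ 2 + k + 1)%N.
  have -> : (\sum_(i < k.+1 + k) v i = \sum_(i < k.+1) i + \sum_(i < k) i)%N.
    rewrite big_split_ord; congr (_ + _)%N; apply: eq_bigr => i _; rewrite /v /=.
      by rewrite ltn_ord.
    by rewrite ltnNge leq_addr addKn.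
  have := sum_ord_double (k.+1 + k); have := sum_ord_double k.+1.
  have := sum_ord_double k.
  rewrite -mulnn.
  move: (\sum_(i < k) i)%N (\sum_(i < k.+1) i)%N (\sum_(i < k.+1 + k) i)%N.
  by move=> x y z; nia.
apply=> i j; case: (split_ordP i) => i' ->.
  rewrite /v /= ltn_ord.
  apply: (eq_quasi _ (orthz_shift_coef_quasi i' j 0)) => n.
  by rewrite /center_mx col_mxEu !mxE addr0.
rewrite /v /= ltnNge leq_addr addKn.
apply: (eq_quasi _ (orthz_shift_coef_quasi i' j 1)) => n.
by rewrite /center_mx col_mxEd !mxE.
Qed.

Lemma sign_absz_add2 (n : int) : (-1) ^+ absz (n + 2) = (-1) ^+ absz n :> int.
Proof.
by rewrite -signr_odd -[RHS]signr_odd; congr (_ ^+ nat_of_bool _); lia.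
Qed.

(** The factor (-1)^n has period two: it does not affect the degree, and it adds
a sign to the reciprocity because n and -n-2k-1 have opposite parities. *)
Lemma Hankel_extension k : exists f : int -> int,
  [/\ forall n : nat, f n%:Z = D (2 * k + 1) n,
      forall n, f (- n - (2 * k + 1)%N%:Z) = (-1) ^+ k.+1 * f n,
      forall n : nat, (0 < n < 2 * k + 1)%N -> f (- n%:Z) = 0
    & quasi (-1) (k ^ 2 + k + 1) f].
Proof.
have [t Ht] := det_window k.
exists (fun n => (-1) ^+ absz n * \det (window_mx k n)); split=> [n|n|n Hn|].
- rewrite Hankel_Christoffel (_ : (2 * k + 1 = k.+1 + k)%N); last by lia.
  congr (_ * _).
    rewrite -signr_odd -[RHS]signr_odd.
    by congr (_ ^+ nat_of_bool _); rewrite oddM; lia.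
  by congr (\det _); apply/matrixP => i j; rewrite !mxE.
- rewrite !Ht (_ : - n - (2 * k + 1)%N%:Z + k%:Z = - 1 - (n + k%:Z)); last by lia.
  rewrite det_center_refl exprS.
  have -> : (-1) ^+ absz (- n - (2 * k + 1)%N%:Z) = - (-1) ^+ absz n :> int.
    rewrite -signr_odd -[in RHS]signr_odd -signrN.
    by congr (_ ^+ nat_of_bool _); lia.
  ring.
- by rewrite Ht det_center_eq0 ?mulr0 //; lia.
have q1 : quasi 1 1 (fun n => (-1) ^+ absz n : int).
  by move=> n; rewrite sign_absz_add2 mul1r subrr.
have qS : quasi (-1) (k ^ 2 + k).+1 (fun n => \det (window_mx k n)).
  apply: eq_quasi (fun n => esym (Ht n)) _.
  rewrite -addn1; apply: quasiZ.
  apply: (@quasi_shift _ _ _ k%:Z (fun N => \det (center_mx k N))).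
  exact: det_center_quasi.
by have := quasiM q1 qS; rewrite mul1r add0n -addn1.
Qed.

(** * Numerator of the generating function *)
Definition den d : {poly int} := (1 + 'X^2) ^+ d.

Lemma denS d i :
  (den d.+1)`_i = (den d)`_i + (if (i < 2)%N then 0 else (den d)`_(i - 2)).
Proof. by rewrite /den exprSr mulrDr mulr1 coefD coefMXn. Qed.

Lemma den0 d : (den d)`_0 = 1.
Proof. by elim: d => [|d IHd]; rewrite ?denS ?IHd ?addr0 // /den expr0 coef1. Qed.

Lemma den_gt d i : (d.*2 < i)%N -> (den d)`_i = 0.
Proof.
elim: d i => [|d IHd] i lti; first by rewrite /den expr0 coef1; case: i lti.
rewrite denS IHd; last by lia.
by rewrite (_ : (i < 2)%N = false) ?IHd ?addr0 //; lia.
Qed.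

Lemma den_sym d i : (i <= d.*2)%N -> (den d)`_(d.*2 - i) = (den d)`_i.
Proof.
elim: d i => [|d IHd] i lei; first by have -> : i = 0%N by lia.
rewrite !denS addrC; congr (_ + _).
  case: ltnP => [lt|ge]; first by rewrite den_gt //; lia.
  rewrite -IHd; last by lia.
  by congr (_ `_ _); lia.
case: ltnP => [lt|ge]; first by rewrite den_gt //; lia.
by rewrite -IHd; [congr (_ `_ _)|]; lia.
Qed.

(** Multiplying the polynomial by 1 + x^2 corresponds to applying E^2 + 1, up to a
shift of the argument m. *)
Lemma den_annihil d f : quasi (-1) d f -> forall m,
  \sum_(i < d.*2.+1) (den d)`_i * f (m - i%:Z) = 0.
Proof.
elim: d f => [|d IHd] f qf m; first by rewrite big1 // => i _; rewrite qf mulr0.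
rewrite -[RHS](IHd _ qf (m - 2)) doubleS.
transitivity (\sum_(i < d.*2.+3) (den d)`_i * f (m - i%:Z)
  + \sum_(i < d.*2.+3)
      (if (i < 2)%N then 0 else (den d)`_(i - 2)) * f (m - i%:Z)).
  by rewrite -big_split; apply: eq_bigr => i _; rewrite denS mulrDl.
rewrite 2!big_ord_recr /= den_gt // (@den_gt _ d.*2.+2) // !mul0r !addr0.
do 2![rewrite [X in _ + X]big_ord_recl /= mul0r add0r].
rewrite -big_split; apply: eq_bigr => i _ /=.
rewrite /bump /= !add1n subSS subSS subn0 mulN1r opprK mulrDr.
by congr (_ * f _ + _ * f _); lia.
Qed.

(** The coefficients of (1 + x^2)^d times the series of the f n, n >= 0. *)
Definition numer (f : int -> int) (d m : nat) : int :=
  \sum_(i < m.+1) (den d)`_i * f (m%:Z - i%:Z).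

(** The full sum of [den_annihil] vanishes; this moves the coefficient to the
values of f at negative integers. *)
Lemma numer_split f d m : quasi (-1) d f -> (m <= d.*2)%N ->
  numer f d m = - \sum_(m.+1 <= i < d.*2.+1) (den d)`_i * f (m%:Z - i%:Z).
Proof.
move=> f_quasi lem; apply/eqP; rewrite -addr_eq0 /numer; apply/eqP.
have := den_annihil f_quasi m.
rewrite -!(big_mkord xpredT (fun i => (den d)`_i * f (m%:Z - i%:Z))).
by rewrite (@big_cat_nat _ _ _ m.+1).
Qed.

(** For e < m <= 2d the remaining terms are values f (m - i) with
-c < m - i < 0, all zero. For m > 2d the sum contains all the coefficients of
the denominator, so it is the full annihilated sum. *)
Lemma numer_eq0 f d e c m :
  d.*2 = (e + c)%N -> (forall n : nat, (0 < n < c)%N -> f (- n%:Z) = 0) ->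
  quasi (-1) d f -> (e < m)%N -> numer f d m = 0.
Proof.
move=> dec f_zero f_quasi ltem; have [lem|gtm] := leqP m d.*2.
  rewrite (numer_split f_quasi) // big_nat big1 ?oppr0 // => i Hi.
  by rewrite (_ : m%:Z - i%:Z = - (i - m)%N%:Z) ?f_zero ?mulr0 //; lia.
rewrite -[RHS](den_annihil f_quasi m) /numer.
rewrite -!(big_mkord xpredT (fun i => (den d)`_i * f (m%:Z - i%:Z))).
rewrite (@big_cat_nat _ _ _ d.*2.+1) //=; last by lia.
rewrite [X in _ + X]big_nat [X in _ + X]big1 ?addr0 // => i Hi.
by rewrite den_gt ?mul0r //; lia.
Qed.

(** After [numer_split] and the symmetry i -> 2d - i of the denominator, the
values of f at negative integers are reflected; those strictly between -c and 0
are the zeros, and the others form the sum for e - m. *)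
Lemma numer_refl f d e c s m :
  d.*2 = (e + c)%N -> (0 < c)%N ->
  (forall n, f (- n - c%:Z) = s * f n) ->
  (forall n : nat, (0 < n < c)%N -> f (- n%:Z) = 0) ->
  quasi (-1) d f ->
  (m <= e)%N -> numer f d m = - s * numer f d (e - m).
Proof.
move=> dec c_gt0 f_refl f_zero f_quasi lem.
rewrite (numer_split f_quasi); last by lia.
rewrite mulNr; congr (- _).
rewrite big_rev_mkord subSS /numer.
rewrite -(big_mkord xpredT (fun i =>
  (den d)`_(d.*2.+1 - i.+1) * f (m%:Z - (d.*2.+1 - i.+1)%N%:Z))).
rewrite (@big_cat_nat _ _ _ (e - m).+1) //=; last by lia.
rewrite [X in _ + X]big_nat [X in _ + X]big1 ?addr0.
  rewrite big_mkord mulr_sumr; apply: eq_bigr => i _; have lti := ltn_ord i.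
  rewrite subSS den_sym; last by lia.
  rewrite (_ : m%:Z - _ = - ((e - m)%N%:Z - i%:Z) - c%:Z) ?f_refl; last by lia.
  by rewrite mulrCA.
move=> i Hi; rewrite subSS.
rewrite (_ : m%:Z - _ = - (- (i - (e - m))%N%:Z) - c%:Z); last by lia.
by rewrite f_refl f_zero ?mulr0 //; lia.
Qed.

Lemma eval_inv_palindrome (B : {poly int}) e (s : int) :
  (size B <= e.+1)%N -> (forall i, (i <= e)%N -> B`_i = s * B`_(e - i)) ->
  tofrac 'X ^+ e * eval_inv_X B = tofrac (s%:P * B).
Proof.
move=> sB Bs.
have X0 : tofrac ('X : {poly int}) != 0 by rewrite tofrac_eq0 polyX_eq0.
(* clear the negative powers, then compare polynomials *)
transitivity (tofrac (\sum_(i < e.+1) (B`_i)%:P * 'X^(e - i))).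
  rewrite /eval_inv_X (@horner_coef_wide _ e.+1); last first.
    by rewrite (leq_trans (size_poly _ _)).
  rewrite mulr_sumr rmorph_sum; apply: eq_bigr => i _ /=.
  rewrite coef_map_id0 ?polyC0 ?tofrac0 // rmorphM rmorphXn /= mulrCA.
  by rewrite exprVn expfB_cond // (negbTE X0) add0n -ltnS.
congr tofrac; rewrite (reindex_inj rev_ord_inj) /=.
rewrite [in RHS](_ : B = \poly_(i < e.+1) B`_i); last first.
  apply/polyP=> i; rewrite coef_poly; case: ltnP => // lei.
  by rewrite nth_default // (leq_trans sB).
rewrite poly_def mulr_sumr; apply: eq_bigr => i _.
have lei : (i <= e)%N by rewrite -ltnS.
rewrite subSS subKn // [in RHS]mul_polyC scalerA mul_polyC.
by rewrite [in LHS]Bs ?subKn ?leq_subr.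
Qed.

Theorem theorem6 (k : nat) :
  exists B : {poly int},
    [/\ fps_is_quotient (fun n => D (2 * k + 1) n) B
          ((1 + 'X^2) ^+ (k ^ 2 + k + 1)),
        size B = (2 * k ^ 2 + 1).+1 &
        tofrac 'X ^+ (2 * k ^ 2 + 1) * eval_inv_X B = tofrac ((-1) ^+ k * B)].
Proof.
have [f [fD f_refl f_zero f_quasi]] := Hankel_extension k.
set d := (k ^ 2 + k + 1)%N; set e := (2 * k ^ 2 + 1)%N.
have dec : (d.*2 = e + (2 * k + 1))%N by rewrite /d /e; lia.
have c0 : (0 < 2 * k + 1)%N by lia.
pose Bc := numer f d.
have Bc0 : Bc 0%N = 1 by rewrite /Bc /numer big_ord1 den0 mul1r subr0 fD D0.
have Bs i : (i <= e)%N -> Bc i = (-1) ^+ k * Bc (e - i)%N.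
  move=> lei; rewrite /Bc (numer_refl dec c0 f_refl f_zero f_quasi lei).
  by rewrite exprS mulN1r opprK.
pose B : {poly int} := \poly_(i < e.+1) Bc i.
have sB : size B = e.+1.
  apply: size_poly_eq; rewrite Bs // subnn Bc0 mulr1.
  by rewrite signr_eq0.
exists B; split=> //.
  split; first by rewrite -/(den d) den0 unitr1.
  move=> n; rewrite /fps_mul /fps_of_poly coef_poly.
  transitivity (Bc n).
    apply: eq_bigr => i _; congr (_ * _); rewrite -fD; congr f.
    by have := ltn_ord i; lia.
  by case: ltnP => // ltn; rewrite /Bc (numer_eq0 dec f_zero f_quasi).
rewrite (@eval_inv_palindrome _ _ ((-1) ^+ k)) ?sB //.
  by rewrite rmorphXn rmorphN1.
by move=> i lei; rewrite !coef_poly !ltnS lei leq_subr Bs.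
Qed.
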